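(* Let $p>3$ be a prime. Then $$\sum_{k=0}^{p-1}\frac{(k+1)\binom{3k}{k}\binom{2k}{k}}{24^k}\equiv\begin{cases}p\Big/\binom{(2p-2)/3}{(p-1)/3}\pmod{p^2} & \text{if } p\equiv 1\pmod 3,\\[2mm] -(p+1)\binom{(2p+2)/3}{(p+1)/3}\pmod{p^2} & \text{if } p\equiv 2\pmod 3.\end{cases}$$
   Context: Congruences modulo $p^2$ between rational numbers whose denominators are prime to $p$ are understood in the ring $\mathbb{Z}_p$ of $p$-adic integers (equivalently, in the localization $\mathbb{Z}_{(p)}$). *)

(* Defs.v *)
From mathcomp Require Import all_boot all_order all_algebra.
Set Implicit Arguments.
Unset Strict Implicit.
Unset Printing Implicit Defensive.
Import GRing.Theory.
Local Open Scope ring_scope.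

(* The localization Z_(p), as a subset of the rationals ([denq] is the
   positive denominator of the reduced fraction). *)
Definition Zloc (p : nat) : pred rat := [pred x : rat | coprimez p%:Z (denq x)].

(* Congruence modulo the ideal m Z_(p) of the ring Z_(p); both sides are
   required to belong to the ring. *)
Definition Zloc_congr (p m : nat) (x y : rat) : Prop :=
  [/\ x \in Zloc p, y \in Zloc p &
      exists2 z : rat, z \in Zloc p & x - y = m%:R * z].

(* Main.v *)
(* The summand is the value at x = 0 of the hypergeometric term
     t(x,k) = ((1-x)/3)_k ((2-x)/3)_k / (k! (1-x/2)_k) (9/8)^k (k+1-x),
   since (1/3)_k (2/3)_k / k!^2 = C(3k,k) C(2k,k) / 27^k.  For an integer N
   prime to 3 the sum f(N) of the t(N,k) terminates, and Zeilberger's method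
   gives 16 N f(N+6) = -(N+5) f(N), hence a product formula for f(N).
   Each t(x,k) with k < p is p-integral and affine in x modulo p^2 along
   x = 0, p, 2p, so the sum in question is 2 f(p) - f(2p) modulo p^2.
   If p = 1 (mod 3), then f(p) = 0 and -f(2p) is p times a quotient evaluated
   modulo p by Wilson's theorem.  If p = 2 (mod 3), put m = (p+1)/3 and
   A = -(p+1) C(2m,m); the quotients f(p)/A and f(2p)/A agree modulo p^2 with
   the values at p and 2p of a function that is affine modulo p^2 and equals 1
   at 0. *)
Require Import Defs.
From HB Require Import structures.
From mathcomp Require Import all_boot all_order all_algebra.
From mathcomp Require Import ring lra zify.
Set Implicit Arguments.
Unset Strict Implicit.
Unset Printing Implicit Defensive.
Import Order.TTheory GRing.Theory Num.Theory.
Local Open Scope ring_scope.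

(** * The terminating sums and their recurrence *)

Section Recurrence.
Variable R : realFieldType.
Implicit Types (a x : R) (k : nat).

Definition poch (a : R) (k : nat) : R := \prod_(i < k) (a + i%:R).

Lemma poch0 a : poch a 0 = 1.
Proof. by rewrite /poch big_ord0. Qed.

Lemma pochS a k : poch a k.+1 = poch a k * (a + k%:R).
Proof. by rewrite /poch big_ord_recr. Qed.

(** Both sides are the product of [a], ..., [a + k]. Without division the identity survives the
    vanishing of a factor. *)
Lemma poch_shift a k : poch (a + 1) k * a = poch a k * (a + k%:R).
Proof.
elim: k => [|k IH]; first by rewrite !poch0; ring.
by rewrite !pochS -natr1 mulrAC IH; ring.
Qed.

Lemma poch_eq0 a n k : a = - n%:R -> (n < k)%N -> poch a k = 0.
Proof.
move=> -> nk; apply/eqP/prodf_eq0; exists (Ordinal nk) => //=.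
by rewrite addNr.
Qed.

Lemma poch_shift2 a k :
  poch (a + 2) k * (a * (a + 1)) = poch a k * ((a + k%:R) * (a + 1 + k%:R)).
Proof.
have -> : a + 2 = a + 1 + 1 by ring.
transitivity (poch (a + 1 + 1) k * (a + 1) * a); first by ring.
by rewrite poch_shift mulrAC poch_shift; ring.
Qed.

Lemma poch_shift3 a k :
  poch (a + 3) k * (a * (a + 1) * (a + 2))
  = poch a k * ((a + k%:R) * (a + 1 + k%:R) * (a + 2 + k%:R)).
Proof.
have -> : a + 3 = a + 2 + 1 by ring.
transitivity (poch (a + 2 + 1) k * (a + 2) * (a * (a + 1))); first by ring.
by rewrite poch_shift mulrAC poch_shift2; ring.
Qed.

Definition term x k : R :=
  poch ((1 - x) / 3) k * poch ((2 - x) / 3) k / (k`!%:R * poch (1 - x / 2) k)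
    * (9 / 8) ^+ k * (k%:R + 1 - x).

(* The common hypergeometric factor of [term x k] and [term (x + 6) k]; both
   are polynomial multiples of it. *)
Definition term_kernel x k : R :=
  poch ((1 - x) / 3 - 2) k * poch ((2 - x) / 3 - 2) k
    / (k`!%:R * poch (1 - x / 2) k) * (9 / 8) ^+ k.

(* The Wilf-Zeilberger certificate, found by solving [cert_step] for the
   coefficients of a cubic polynomial in [k]. *)
Definition cert x (k : R) : R :=
  ((81 * x ^+ 2 + 486 * x + 648) * k ^+ 3
   - (155 * x ^+ 3 + 1301 * x ^+ 2 + 3466 * x + 2968) * k ^+ 2
   + (91 * x ^+ 4 + 1022 * x ^+ 3 + 4140 * x ^+ 2 + 7144 * x + 4448) * k
   - (17 * x ^+ 5 + 243 * x ^+ 4 + 1334 * x ^+ 3 + 3504 * x ^+ 2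
      + 4400 * x + 2112))
  / (2 * x * (x + 1) * (x + 2) ^+ 2 * (x + 4) ^+ 2).

Lemma natr_fact_neq0 k : k`!%:R != 0 :> R.
Proof. by rewrite pnatr_eq0 -lt0n fact_gt0. Qed.

(** Two unit shifts of each numerator parameter. For [0 < x] the four shifted parameters are
    negative, so the divisions are legitimate. *)
Lemma term_kernelE x k : 0 < x ->
  term x k = term_kernel x k * (k%:R + 1 - x)
    * ((k%:R - (x + 5) / 3) * (k%:R - (x + 2) / 3)
       * (k%:R - (x + 4) / 3) * (k%:R - (x + 1) / 3))
    / ((x + 5) / 3 * ((x + 2) / 3) * ((x + 4) / 3) * ((x + 1) / 3)).
Proof.
move=> x0.
have shift a : a - 2 != 0 -> a - 1 != 0 ->
    poch a k = poch (a - 2) k * ((a - 2 + k%:R) * (a - 1 + k%:R))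
               / ((a - 2) * (a - 1)).
  move=> a2 a1; have := poch_shift2 (a - 2) k.
  rewrite subrK (_ : a - 2 + 1 = a - 1); last by ring.
  by move=> <-; rewrite mulfK ?mulf_neq0.
rewrite /term (shift ((1 - x) / 3)) ?(shift ((2 - x) / 3)) /term_kernel;
  try by apply: ltr0_neq0; lra.
set d := (_ * poch _ _)^-1; set A := poch _ _; set B := poch _ _.
set e := (9 / 8) ^+ k.
have -> : (1 - x) / 3 - 2 = - ((x + 5) / 3) by field.
have -> : (1 - x) / 3 - 1 = - ((x + 2) / 3) by field.
have -> : (2 - x) / 3 - 2 = - ((x + 4) / 3) by field.
have -> : (2 - x) / 3 - 1 = - ((x + 1) / 3) by field.
move: ((x + 5) / 3) ((x + 2) / 3) ((x + 4) / 3) ((x + 1) / 3) => x5 x2 x4 x1.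
by rewrite !mulrNN !invfM; ring.
Qed.

(** Replacing [x] by [x + 6] lowers the numerator parameters by 2, which gives those of the kernel,
    and the denominator parameter by 3; only the latter has to be rewritten. *)
Lemma term_shift_kernel x k : 0 < x -> poch (1 - x / 2) k != 0 ->
  term (x + 6) k = term_kernel x k * (k%:R - 5 - x)
    * ((x / 2 - k%:R) * ((x + 2) / 2 - k%:R) * ((x + 4) / 2 - k%:R))
    / (x / 2 * ((x + 2) / 2) * ((x + 4) / 2)).
Proof.
move=> x0 c0.
set L := (X in _ * X / _); set X := (X in _ / X).
have X0 : X != 0 by rewrite lt0r_neq0 // !mulr_gt0 // ?invr_gt0 //; lra.
have e : poch (1 - (x + 6) / 2) k * L = poch (1 - x / 2) k * X.
  have := poch_shift3 (1 - (x + 6) / 2) k.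
  rewrite (_ : 1 - (x + 6) / 2 + 3 = 1 - x / 2); last by field.
  have -> : (1 - (x + 6) / 2) * (1 - (x + 6) / 2 + 1) * (1 - (x + 6) / 2 + 2) = - X.
    by rewrite /X; field.
  have -> : (1 - (x + 6) / 2 + k%:R) * (1 - (x + 6) / 2 + 1 + k%:R)
            * (1 - (x + 6) / 2 + 2 + k%:R) = - L.
    by rewrite /L; field.
  by rewrite !mulrN => /oppr_inj.
(* Through [e], the shifted denominator and [L] are nonzero as well. *)
have : poch (1 - x / 2) k * X != 0 by rewrite mulf_neq0.
rewrite -e mulf_eq0 negb_or => /andP[d0 l0].
have e3 : (poch (1 - (x + 6) / 2) k)^-1 = (poch (1 - x / 2) k)^-1 * L / X.
  have -> : L = poch (1 - x / 2) k * X / poch (1 - (x + 6) / 2) k.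
    by rewrite -e mulrAC mulfV ?mul1r.
  by field; rewrite X0 c0 d0.
clearbody L X; rewrite /term /term_kernel !invfM e3.
have -> : (1 - (x + 6)) / 3 = (1 - x) / 3 - 2 by field.
have -> : (2 - (x + 6)) / 3 = (2 - x) / 3 - 2 by field.
by ring.
Qed.

(** The Wilf-Zeilberger equation with right side G(k+1) - G(k), divided by the kernel, where G(k) =
    [term_kernel x k * k * (k - x / 2) * cert x k]. The factor 9/8 (k - (x+5)/3) (k - (x+4)/3) comes
    from the ratio of consecutive kernels. *)
Lemma cert_step x (k : R) : 0 < x ->
  (k - 5 - x) * ((x / 2 - k) * ((x + 2) / 2 - k) * ((x + 4) / 2 - k))
    / (x / 2 * ((x + 2) / 2) * ((x + 4) / 2))
  + (x + 5) / (16 * x) * ((k + 1 - x)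
    * ((k - (x + 5) / 3) * (k - (x + 2) / 3)
       * (k - (x + 4) / 3) * (k - (x + 1) / 3))
    / ((x + 5) / 3 * ((x + 2) / 3) * ((x + 4) / 3) * ((x + 1) / 3)))
  = 9 / 8 * (k - (x + 5) / 3) * (k - (x + 4) / 3) * cert x (k + 1)
    - k * (k - x / 2) * cert x k.
Proof.
by move=> x0; rewrite /cert; field; rewrite !gt_eqF //; lra.
Qed.

(** The sum telescopes to G(K+1), as G(0) = 0. Writing G(K+1) with the kernel at [K] keeps the
    nonvanishing condition at [K]. *)
Lemma sum_term_rec x K : 0 < x -> poch (1 - x / 2) K != 0 ->
  \sum_(k < K.+1) (term (x + 6) k + (x + 5) / (16 * x) * term x k)
  = term_kernel x K * (9 / 8 * (K%:R - (x + 5) / 3) * (K%:R - (x + 4) / 3)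
                * cert x (K%:R + 1)).
Proof.
move=> x0.
have step k : poch (1 - x / 2) k != 0 ->
    term (x + 6) k + (x + 5) / (16 * x) * term x k
    = term_kernel x k * (9 / 8 * (k%:R - (x + 5) / 3) * (k%:R - (x + 4) / 3)
        * cert x (k%:R + 1) - k%:R * (k%:R - x / 2) * cert x k%:R).
  by move=> ck; rewrite -cert_step // term_shift_kernel // term_kernelE //; ring.
elim: K => [|k IH] cK.
  by rewrite big_ord1 step // mul0r mul0r subr0.
rewrite big_ord_recr step //=.
move: cK; rewrite pochS mulf_eq0 negb_or => /andP[ck ck1].
rewrite IH //.
have -> : term_kernel x k.+1 = term_kernel x k * (9 / 8 * (k%:R - (x + 5) / 3)
   * (k%:R - (x + 4) / 3)) / (k.+1%:R * (k.+1%:R - x / 2)).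
  rewrite /term_kernel factS natrM !pochS exprS -(natr1 k).
  rewrite (_ : (1 - x) / 3 - 2 + k%:R = k%:R - (x + 5) / 3); last by field.
  rewrite (_ : (2 - x) / 3 - 2 + k%:R = k%:R - (x + 4) / 3); last by field.
  rewrite (_ : k%:R + 1 - x / 2 = 1 - x / 2 + k%:R); last by ring.
  by rewrite !invfM; ring.
have k1 : k%:R + 1 != 0 :> R by rewrite natr1 pnatr_eq0.
rewrite -(natr1 k) (_ : k%:R + 1 - x / 2 = 1 - x / 2 + k%:R); last by ring.
move: (cert x _) (cert x _) (term_kernel x k) (1 - x / 2 + k%:R) ck1 => c1 c2 b w w0.
by field; rewrite w0 k1.
Qed.

(* For even [N] the factor [poch (1 - N / 2) k] in the denominators vanishes
   when [k >= N / 2], but these indices are beyond the range of summation. *)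
Definition hsum (N : nat) : R := \sum_(k < (N %/ 3).+1) term N%:R k.

Lemma term_eq0 N k : (N %% 3 != 0)%N -> (N %/ 3 < k)%N -> term N%:R k = 0.
Proof.
move=> N3 nk; rewrite /term; set n := (N %/ 3)%N in nk.
suff -> : poch ((1 - N%:R) / 3) k * poch ((2 - N%:R) / 3) k = 0 :> R.
  by rewrite !mul0r.
have : (N = 3 * n + 1 \/ N = 3 * n + 2)%N by rewrite /n; lia.
case=> ->; rewrite natrD natrM.
  by rewrite (poch_eq0 _ nk) ?mul0r //; field.
by rewrite [poch ((2 - _) / 3) k](poch_eq0 _ nk) ?mulr0 //; field.
Qed.

Lemma sum_term N K : (N %% 3 != 0)%N -> (N %/ 3 < K)%N ->
  \sum_(k < K) term N%:R k = hsum N.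
Proof.
move=> N3 nK; rewrite /hsum -(subnKC nK) big_split_ord /= [X in _ + X]big1 ?addr0 //.
by move=> i _; rewrite term_eq0 //=; lia.
Qed.

(** For the even [N] up to 10 prime to 3, a denominator met in the telescoping vanishes; this is
    what the second hypothesis excludes. *)
Lemma hsum_rec N : (N %% 3 != 0)%N -> odd N || (10 < N)%N ->
  hsum (N + 6) = - ((N + 5)%:R / (16 * N)%:R) * hsum N.
Proof.
move=> N3 oN; have N0 : (0 < N)%N by case: N N3 oN.
(* The upper limit [N %/ 3 + 2] is the last index of the sum at [N + 6]. *)
have c0 : poch (1 - N%:R / 2) (N %/ 3 + 2) != 0 :> R.
  apply/prodf_neq0 => i _; have ne : (2 * i + 2 != N)%N.
    by have := ltn_ord i; case/orP: oN; lia.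
  apply: contra_neq ne => e; apply/eqP; rewrite -(eqr_nat R) natrD natrM.
  apply/eqP; lra.
have := sum_term_rec _ c0; rewrite ltr0n => /(_ N0).
rewrite big_split /= -mulr_sumr -natrD !sum_term; try lia.
(* The boundary term vanishes: at k = [N %/ 3 + 2] either k = (N+5)/3 or k = (N+4)/3, according to
   [N] modulo 3. *)
set r := (X in _ = X); have -> : r = 0.
  rewrite /r; have : (N = 3 * (N %/ 3) + 1 \/ N = 3 * (N %/ 3) + 2)%N by lia.
  move: (N %/ 3)%N (cert _ _) (term_kernel _ _) => n u v [] ->;
    rewrite (natrD _ n) (natrD _ (3 * n)) natrM.
    by field.
  by field.
move/eqP; rewrite addr_eq0 => /eqP ->.
by rewrite natrD natrM mulNr.
Qed.

Lemma hsum_iter c r j0 j : (r %% 3 != 0)%N -> odd r || (10 < 6 * j0 + r)%N ->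
  hsum (6 * j0 + r) = c * \prod_(i < j0) - ((6 * i + r + 5)%:R / (16 * (6 * i + r))%:R) ->
  (j0 <= j)%N ->
  hsum (6 * j + r) = c * \prod_(i < j) - ((6 * i + r + 5)%:R / (16 * (6 * i + r))%:R).
Proof.
move=> r3 h h0 /subnKC <-; elim: (j - j0)%N => [|d IH]; first by rewrite addn0.
rewrite addnS big_ord_recr /= mulrA -IH.
rewrite (_ : 6 * (j0 + d).+1 + r = 6 * (j0 + d) + r + 6)%N; last by lia.
by rewrite hsum_rec 1?mulrC //; lia.
Qed.

Ltac expand_hsum := rewrite /hsum /term /divn /= !(big_ord_recr, big_ord0) /=
  !(pochS, poch0, factS, fact0, exprS, expr0).

Lemma hsum_1mod6 j : hsum (6 * j + 1) = 0.
Proof.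
rewrite (@hsum_iter 0 1 0) ?mul0r //.
(* The sum at 1 is its term k = 0, whose factor k + 1 - x is zero. *)
by rewrite /hsum big_ord1 /term add0r subrr mulr0.
Qed.

Lemma hsum_5mod6 j :
  hsum (6 * j + 5) = - \prod_(i < j) - ((6 * i + 10)%:R / (16 * (6 * i + 5))%:R).
Proof.
rewrite (@hsum_iter (-1) 5 0) ?mulN1r //.
  by under eq_bigr do rewrite -addnA.
by rewrite big_ord0; expand_hsum; field.
Qed.

Lemma hsum_2mod6 j : (1 < j)%N ->
  hsum (6 * j + 2) = - \prod_(i < j) - ((6 * i + 7)%:R / (16 * (6 * i + 2))%:R).
Proof.
move=> j1; rewrite (@hsum_iter (-1) 2 2) ?mulN1r //.
  by under eq_bigr do rewrite -addnA.
by rewrite !big_ord_recr big_ord0 /=; expand_hsum; field.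
Qed.

Lemma hsum_4mod6 j : (0 < j)%N -> hsum (6 * j + 4)
  = - (3 / 2) * \prod_(i < j) - ((6 * i + 9)%:R / (16 * (6 * i + 4))%:R).
Proof.
case: j => // -[|j] _.
  (* The value at 10, needed for p = 5, is computed directly; the iteration starts at 16. *)
  by rewrite big_ord_recr big_ord0 /=; expand_hsum; field.
rewrite (@hsum_iter (- (3 / 2)) 4 2) //.
  by under eq_bigr do rewrite -addnA.
by rewrite !big_ord_recr big_ord0 /=; expand_hsum; field.
Qed.

End Recurrence.

(** * The localization and functions affine modulo p^2 *)

Lemma Zloc_frac (p : nat) (a d : int) : d != 0 -> coprimez p%:Z d ->
  a%:~R / d%:~R \in Zloc p.
Proof.
move=> d0 pd; have ea : a%:~R = a%:~R / d%:~R * d%:~R :> rat.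
  by rewrite divfK ?intr_eq0.
move: (_ / _) ea => x ea.
have e : numq x * d = a * denq x.
  by apply: (@intr_inj rat); rewrite !rmorphM /= numqE ea mulrAC.
(* Gauss's lemma: the reduced denominator divides every denominator. *)
have : (denq x %| d)%Z.
  rewrite -(@Gauss_dvdzr _ (numq x)); first by rewrite e dvdz_mull.
  by rewrite coprimez_sym coprimezE coprime_num_den.
rewrite inE => h; apply: coprimez_dvdr h pd.
Qed.

Fact Zloc_subring_closed p : subring_closed (Zloc p).
Proof.
have den x : x \in Zloc p -> exists a d : int,
   [/\ d != 0, coprimez p%:Z d & x = a%:~R / d%:~R].
  by exists (numq x), (denq x); rewrite denq_neq0 divq_num_den.
split=> [|x y|x y].
- by rewrite inE coprimezE coprimen1.
- move=> /den[a [d [d0 pd ->]]] /den[b [e [e0 pe ->]]].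
  have -> : a%:~R / d%:~R - b%:~R / e%:~R = (a * e - b * d)%:~R / (d * e)%:~R :> rat.
    by rewrite rmorphB !rmorphM /=; field; rewrite !intr_eq0 d0 e0.
  by apply: Zloc_frac; rewrite ?mulf_neq0 // coprimezMr pd.
- move=> /den[a [d [d0 pd ->]]] /den[b [e [e0 pe ->]]].
  have -> : a%:~R / d%:~R * (b%:~R / e%:~R) = (a * b)%:~R / (d * e)%:~R :> rat.
    by rewrite !rmorphM /=; field; rewrite !intr_eq0 d0 e0.
  by apply: Zloc_frac; rewrite ?mulf_neq0 // coprimezMr pd.
Qed.
HB.instance Definition _ p :=
  GRing.isSubringClosed.Build rat (Zloc p) (Zloc_subring_closed p).

Lemma ZlocD p x y : x \in Zloc p -> y \in Zloc p -> x + y \in Zloc p.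
Proof. exact: rpredD. Qed.

Lemma ZlocM p x y : x \in Zloc p -> y \in Zloc p -> x * y \in Zloc p.
Proof. exact: rpredM. Qed.

Lemma ZlocN p x : x \in Zloc p -> - x \in Zloc p.
Proof. by rewrite rpredN. Qed.

Lemma ZlocX p x n : x \in Zloc p -> x ^+ n \in Zloc p.
Proof. by move=> Zx; rewrite rpredX. Qed.

Lemma Zloc_nat p n : n%:R \in Zloc p.
Proof. exact: rpred_nat. Qed.

Ltac Zloc_closed := repeat lazymatch goal with
  | |- is_true (_ + _ \in Zloc _) => apply: ZlocD
  | |- is_true (_ * _ \in Zloc _) => apply: ZlocM
  | |- is_true (- _ \in Zloc _) => apply: ZlocN
  | |- is_true (_ ^+ _ \in Zloc _) => apply: ZlocX
  | |- is_true (_%:R \in Zloc _) => apply: Zloc_nat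
  | |- is_true (1 \in Zloc _) => apply: rpred1
  | |- is_true (0 \in Zloc _) => apply: rpred0
  | |- is_true (_ \in Zloc _) => assumption
  end.

(** The units of Z_(p). Since the inverse of 0 is 0 by convention, 0 has to be excluded
    explicitly. *)
Definition Zunit (p : nat) : pred rat :=
  [pred x | [&& x != 0, x \in Zloc p & x^-1 \in Zloc p]].

Lemma ZunitZ p x : x \in Zunit p -> x \in Zloc p.
Proof. by case/and3P. Qed.

Lemma ZunitV p x : x \in Zunit p -> x^-1 \in Zunit p.
Proof. by case/and3P=> x0 Zx Zx'; rewrite inE invr_eq0 invrK x0 Zx' Zx. Qed.

Lemma Zunit_neq0 p x : x \in Zunit p -> x != 0.
Proof. by case/and3P. Qed.

Lemma ZunitM p x y : x \in Zunit p -> y \in Zunit p -> x * y \in Zunit p.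
Proof.
case/and3P=> x0 Zx Zx' /and3P[y0 Zy Zy'].
by rewrite inE mulf_neq0 // invfM !rpredM.
Qed.

Lemma Zunit_prod p (I : Type) (r : seq I) (P : pred I) (F : I -> rat) :
  (forall i, P i -> F i \in Zunit p) -> \prod_(i <- r | P i) F i \in Zunit p.
Proof.
move=> h; elim/big_ind: _ => //; last exact: ZunitM.
by rewrite inE invr1 rpred1 oner_neq0.
Qed.

Section Prime.
Variable p : nat.
Hypothesis p_pr : prime p.

Lemma Zunit_int (d : int) : coprimez p%:Z d -> d%:~R \in Zunit p.
Proof.
move=> pd; have d0 : d != 0.
  by apply: contraTneq pd => ->; rewrite coprimezE /coprime gcdn0 gtn_eqF ?prime_gt1.
rewrite inE intr_eq0 d0 rpred_int /= -div1r.
by have := @Zloc_frac p 1 d d0 pd.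
Qed.

Lemma Zunit_nat n : ~~ (p %| n)%N -> n%:R \in Zunit p.
Proof.
by move=> pn; rewrite pmulrn Zunit_int // coprimezE prime_coprime.
Qed.

Lemma Zunit_small n : (0 < n < p)%N -> n%:R \in Zunit p.
Proof. by case/andP=> n0 np; rewrite Zunit_nat // gtnNdvd. Qed.

(** After division by [u] this concerns 1 + p b, whose numerator [denq b + p * numq b] is prime to
    p. *)
Lemma ZunitD u a : u \in Zunit p -> a \in Zloc p -> u + p%:R * a \in Zunit p.
Proof.
move=> Uu Za; have [u0 Zu Zu'] := and3P Uu.
have -> : u + p%:R * a = u * (1 + p%:R * (a / u)) by field.
apply: ZunitM => //.
have : a / u \in Zloc p by rewrite rpredM.
move: (a / u) => b Zb; rewrite -(divq_num_den b).
have -> : 1 + p%:R * ((numq b)%:~R / (denq b)%:~R)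
   = (denq b + p%:Z * numq b)%:~R / (denq b)%:~R :> rat.
  by rewrite rmorphD rmorphM /=; field; rewrite intr_eq0 denq_neq0.
apply: ZunitM; last exact/ZunitV/Zunit_int.
by apply: Zunit_int; rewrite addrC mulrC /coprimez gcdzMDl.
Qed.


(* u, v, w play the role of the values at 0, p and 2p of one function. *)
Definition affine (u v w : rat) : Prop :=
  u \in Zloc p /\ exists2 a, a \in Zloc p &
    v = u + p%:R * a /\
    exists2 c, c \in Zloc p & w = u + 2 * p%:R * a + p%:R ^+ 2 * c.

Lemma affine_linear u a v w : u \in Zloc p -> a \in Zloc p ->
  v = u + p%:R * a -> w = u + 2 * p%:R * a -> affine u v w.
Proof.
move=> Zu Za -> ->; split=> //; exists a => //; split=> //.
by exists 0; rewrite ?rpred0 // mulr0 addr0.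
Qed.

Lemma affine_cst u : u \in Zloc p -> affine u u u.
Proof. by move=> Zu; apply: (@affine_linear u 0); rewrite ?rpred0 // mulr0 addr0. Qed.

Lemma affineD u v w u' v' w' :
  affine u v w -> affine u' v' w' -> affine (u + u') (v + v') (w + w').
Proof.
case=> Zu [a Za [-> [c Zc ->]]] [Zu' [a' Za' [-> [c' Zc' ->]]]].
split; first by rewrite rpredD.
exists (a + a'); first by rewrite rpredD.
split; first by ring.
by exists (c + c'); [rewrite rpredD | ring].
Qed.

Lemma affineM u v w u' v' w' :
  affine u v w -> affine u' v' w' -> affine (u * u') (v * v') (w * w').
Proof.
case=> Zu [a Za [-> [c Zc ->]]] [Zu' [a' Za' [-> [c' Zc' ->]]]].
split; first by rewrite rpredM.
(* The term p a a' makes the value at p exact; the error at 2p is then a multiple of p^2. *)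
exists (a * u' + u * a' + p%:R * a * a'); first by Zloc_closed.
split; first by ring.
exists (2 * a * a' + u * c' + c * u'
        + 2 * p%:R * (a * c' + c * a') + p%:R ^+ 2 * c * c').
  by Zloc_closed.
ring.
Qed.

Lemma affine_sum n (u v w : nat -> rat) :
  (forall i, (i < n)%N -> affine (u i) (v i) (w i)) ->
  affine (\sum_(i < n) u i) (\sum_(i < n) v i) (\sum_(i < n) w i).
Proof.
elim: n => [|n IH] h; first by rewrite !big_ord0; apply/affine_cst/rpred0.
rewrite !big_ord_recr; apply: affineD; last exact: h.
by apply: IH => i /ltnW/h.
Qed.

Lemma affine_prod n (u v w : nat -> rat) :
  (forall i, (i < n)%N -> affine (u i) (v i) (w i)) ->
  affine (\prod_(i < n) u i) (\prod_(i < n) v i) (\prod_(i < n) w i).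
Proof.
elim: n => [|n IH] h; first by rewrite !big_ord0; apply/affine_cst/rpred1.
rewrite !big_ord_recr; apply: affineM; last exact: h.
by apply: IH => i /ltnW/h.
Qed.

Lemma affineV u v w : u \in Zunit p -> affine u v w -> affine u^-1 v^-1 w^-1.
Proof.
move=> Uu [Zu [a Za [ev [c Zc ew]]]].
have Uv : v \in Zunit p by rewrite ev ZunitD.
have Uw : w \in Zunit p.
  have -> : w = u + p%:R * (2 * a + p%:R * c) by rewrite ew; ring.
  by apply: ZunitD => //; Zloc_closed.
have u0 := Zunit_neq0 Uu; have v0 := Zunit_neq0 Uv; have w0 := Zunit_neq0 Uw.
have Zi x : x \in Zunit p -> x^-1 \in Zloc p by move/ZunitV/ZunitZ.
split; first exact: Zi.
(* This slope is forced by 1/v - 1/u = (u - v)/(u v). *)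
exists (- a / (u * v)); first by rewrite invfM; Zloc_closed; apply: Zi.
split.
  apply: (mulfI (mulf_neq0 u0 v0)); rewrite ev in v0 *.
  by field; rewrite u0 v0.
exists ((2 * a ^+ 2 + 2 * p%:R * a * c - c * v) / (u * v * w)).
  by rewrite !invfM; Zloc_closed; try exact: Zi; apply: ZunitZ.
rewrite ew ev in v0 w0 *.
by field; rewrite u0 v0 w0.
Qed.

End Prime.

(** * The summand as a value at 0, and its affine dependence on x *)

Lemma poch1 (R : realFieldType) k : poch (1 : R) k = k`!%:R.
Proof.
elim: k => [|k IH]; first by rewrite poch0 fact0.
by rewrite pochS IH factS natrM -(natr1 k); ring.
Qed.

(** Gauss's triplication: the factors of (3k)! sorted by residue modulo 3. *)
Lemma poch_triple (R : realFieldType) k :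
  poch (3^-1 : R) k * poch (2 / 3) k * k`!%:R * 27 ^+ k = (3 * k)`!%:R.
Proof.
elim: k => [|k IH]; first by rewrite !poch0 muln0 fact0; ring.
rewrite (_ : 3 * k.+1 = (3 * k).+3)%N; last by lia.
rewrite !pochS !factS exprS !natrM -IH -[(3 * k).+3]addn3 -[(3 * k).+2]addn2.
rewrite -[(3 * k).+1]addn1 !(natrD _ (3 * k)) natrM -(natr1 k).
by field.
Qed.

Lemma bin_triple k : ('C(3 * k, k) * 'C(2 * k, k) * k`! ^ 3 = (3 * k)`!)%N.
Proof.
rewrite -(@bin_fact (3 * k) k); last by lia.
rewrite (_ : 3 * k - k = 2 * k)%N; last by lia.
rewrite -(@bin_fact (2 * k) k); last by lia.
rewrite (_ : 2 * k - k = k)%N; last by lia.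
ring.
Qed.

Lemma term_at0 (R : realFieldType) k :
  term (0 : R) k = (k + 1)%:R * 'C(3 * k, k)%:R * 'C(2 * k, k)%:R / 24%:R ^+ k.
Proof.
have f0 := natr_fact_neq0 R k.
rewrite /term !subr0 mul0r subr0 poch1 mul1r natrD.
have e : poch 3^-1 k * poch (2 / 3) k
   = 'C(3 * k, k)%:R * 'C(2 * k, k)%:R * k`!%:R ^+ 2 / 27 ^+ k :> R.
  apply: (mulIf f0); apply: (mulIf (x := 27 ^+ k)); first by rewrite expf_neq0 ?pnatr_eq0.
  rewrite poch_triple -bin_triple !natrM.
  by field; rewrite expf_neq0 ?pnatr_eq0.
rewrite e (_ : 24%:R ^+ k = 27 ^+ k / (9 / 8) ^+ k :> R).
  by field; rewrite f0 !expf_neq0 ?mulf_neq0 ?invr_neq0 ?pnatr_eq0.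
by rewrite -expr_div_n; congr (_ ^+ _); field.
Qed.

Section Prime.
Variable p : nat.
Hypothesis p_pr : prime p.
Hypothesis p_gt3 : (3 < p)%N.

Lemma Zunit2 : 2 \in Zunit p.
Proof. by apply: Zunit_small => //; lia. Qed.

Lemma Zunit3 : 3 \in Zunit p.
Proof. by apply: Zunit_small => //; lia. Qed.

Lemma ZlocV x : x \in Zunit p -> x^-1 \in Zloc p.
Proof. by move/ZunitV/ZunitZ. Qed.

Lemma Zunit_fact n : (n < p)%N -> n`!%:R \in Zunit p.
Proof.
move=> np; rewrite -poch1; apply: Zunit_prod => i _.
by rewrite addrC natr1; apply: Zunit_small => //; have := ltn_ord i; lia.
Qed.

Lemma ZunitX x n : x \in Zunit p -> x ^+ n \in Zunit p.
Proof.
move=> Ux; elim: n => [|n IH]; last by rewrite exprS ZunitM.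
by rewrite expr0 inE invr1 rpred1 oner_neq0.
Qed.

Lemma poch_affine a b v w k : a \in Zloc p -> b \in Zloc p ->
  v = a + p%:R * b -> w = a + 2 * p%:R * b ->
  affine p (poch a k) (poch v k) (poch w k).
Proof.
move=> Za Zb -> ->.
apply: (@affine_prod _ _ (fun i => a + i%:R) (fun i => a + p%:R * b + i%:R)
                       (fun i => a + 2 * p%:R * b + i%:R)) => i _.
by apply: (@affine_linear _ _ b); rewrite ?rpredD ?rpred_nat //; ring.
Qed.

(** Each factor is constant or linear in x, with slope -1, -1/3 or -1/2. The inversion needs a unit
    only at x = 0, where the denominator is k!^2; this is where [k < p] enters. *)
Lemma term_affine k : (k < p)%N ->
  affine p (term 0 k) (term p%:R k) (term (2 * p)%:R k).
Proof.
move=> kp; rewrite /term natrM.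
have Z2 := ZlocV Zunit2; have Z3 := ZlocV Zunit3.
apply: affineM; last first.
  by apply: (@affine_linear _ _ (-1)); try (Zloc_closed; rewrite ?rpred0); ring.
apply: affineM; last first.
  apply: affine_cst; rewrite ZlocX // (_ : 9 / 8 = 9 * 2^-1 ^+ 3); last by field.
  by Zloc_closed.
apply: affineM.
  by apply: affineM; apply: (@poch_affine _ (- 3^-1)); rewrite ?subr0; Zloc_closed; field.
apply: affineV => //.
  rewrite mul0r subr0 poch1; apply: ZunitM; exact: Zunit_fact.
apply: affineM; first exact/affine_cst/Zloc_nat.
by apply: (@poch_affine _ (- 2^-1)); rewrite ?mul0r ?subr0; Zloc_closed; field.
Qed.

(** The range k < p contains the ranges of both terminating sums, so all three sums can be compared
    term by term. *)
Lemma sum_term_affine : (p %% 3 != 0)%N ->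
  affine p (\sum_(k < p) term 0 k) (hsum _ p) (hsum _ (2 * p)).
Proof.
move=> p3; rewrite -(@sum_term _ p p) -?(@sum_term _ (2 * p) p); try lia.
exact: (@affine_sum _ p _ _ _ term_affine).
Qed.

End Prime.

(** * Products and factorials *)

Lemma prod_ord_cat (R : pzRingType) m n (F : nat -> R) :
  \prod_(i < m + n) F i = (\prod_(i < m) F i) * \prod_(i < n) F (m + i)%N.
Proof. by rewrite big_split_ord. Qed.

Lemma prod_ord_rev (R : comPzRingType) n (F : nat -> R) :
  \prod_(i < n) F i = \prod_(i < n) F (n - i.+1)%N.
Proof. by rewrite (reindex_inj rev_ord_inj). Qed.

Lemma prod_natrS (R : pzRingType) n : \prod_(i < n) i.+1%:R = n`!%:R :> R.
Proof.
elim: n => [|n IH]; first by rewrite big_ord0.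
by rewrite big_ord_recr /= IH -natrM factS mulnC.
Qed.

Lemma prod_mulr_cst (R : comPzRingType) n (c : R) (F : nat -> R) :
  \prod_(i < n) (c * F i) = c ^+ n * \prod_(i < n) F i.
Proof. by rewrite big_split /= prodr_const card_ord. Qed.

Lemma fact_cat (R : pzRingType) m n :
  (m + n)`!%:R = m`!%:R * \prod_(i < n) (m + i).+1%:R :> R.
Proof. by rewrite -!prod_natrS (prod_ord_cat _ _ (fun i => i.+1%:R)). Qed.

(** * Factorials modulo p and the case p = 6 l + 1 *)

Section ModP.
Variables (p : nat) (F : fieldType).
Hypothesis p_pr : prime p.
Hypothesis pF : p \in [pchar F].

(** Induction from Wilson's theorem: one factor at a time passes from the second factorial to the
    first, at the cost of a sign. *)
Lemma Wilson_fact k : (k < p)%N ->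
  k`!%:R * (p.-1 - k)`!%:R = - (-1) ^+ k :> F.
Proof.
elim: k => [|k IH] kp.
  rewrite fact0 subn0 mul1r expr0; apply/eqP.
  have := Wilson (prime_gt1 p_pr); rewrite p_pr => /esym.
  by rewrite (dvdn_pcharf pF) -natr1 addr_eq0.
rewrite exprS mulN1r opprK -[RHS]opprK -IH 1?ltnW //.
have -> : (p.-1 - k = (p.-1 - k.+1).+1)%N by lia.
rewrite !factS !natrM; suff -> : k.+1%:R = - (p.-1 - k.+1).+1%:R :> F by ring.
apply/eqP; rewrite -addr_eq0 -natrD -(dvdn_pcharf pF).
by rewrite (_ : _ + _ = p)%N //; lia.
Qed.

Lemma fact_neq0 k : (k < p)%N -> k`!%:R != 0 :> F.
Proof.
move/Wilson_fact => h; apply: contra_eq_neq h => ->.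
by rewrite mul0r eq_sym oppr_eq0 signr_eq0.
Qed.

Lemma Fermat_natr n : ~~ (p %| n)%N -> n%:R ^+ p.-1 = 1 :> F.
Proof.
rewrite (dvdn_pcharf pF) => n0; apply: (mulfI n0).
rewrite mulr1 -exprS prednK ?prime_gt0 //.
by have := pFrobenius_aut_nat pF n; rewrite pFrobenius_autE.
Qed.

End ModP.

Lemma fact_double (R : comPzRingType) k :
  (2 * k)`!%:R = 2 ^+ k * k`!%:R * \prod_(i < k) (2 * i + 1)%:R :> R.
Proof.
elim: k => [|k IH]; first by rewrite big_ord0 muln0 fact0 expr0 !mul1r.
rewrite (_ : 2 * k.+1 = (2 * k).+2)%N ?big_ord_recr /=; last by lia.
rewrite !factS exprS !natrM IH -[(2 * k).+2]addn2 -[(2 * k).+1]addn1.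
by rewrite !(natrD _ (2 * k)) natrM -(natr1 k); ring.
Qed.

(** The two products on the left are the numerator of the closed form of f(2p) without its factor p.
    As 6l = -1 in [F], each product is a power times a factorial, and Wilson and Fermat relate
    these. *)
Lemma binomial_mod_p l (F : fieldType) : (0 < l)%N -> prime (6 * l + 1) ->
  (6 * l + 1)%N \in [pchar F] ->
  (\prod_(i < l.-1) (6 * i + 7)%:R) * (\prod_(i < l) (6 * (l + i) + 7)%:R)
    * 'C(4 * l, 2 * l)%:R
  = 16 ^+ (2 * l) * \prod_(i < 2 * l) (6 * i + 2)%:R :> F.
Proof.
move=> l0 p_pr pF; set p := (6 * l + 1)%N in p_pr pF.
have p0 : 6 * l%:R + 1 = 0 :> F.
  by rewrite -natrM natr1 -addn1 (pcharf0 pF).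
have X1 : \prod_(i < l.-1) (6 * i + 7)%:R = (-6) ^+ l.-1 * l.-1`!%:R :> F.
  rewrite -prod_natrS -(prod_mulr_cst _ _ (fun i => i.+1%:R)).
  rewrite (prod_ord_rev _ (fun i => - 6 * i.+1%:R)); apply: eq_bigr => i _.
  have -> : (l.-1 - i.+1).+1%:R = l%:R - i.+1%:R :> F.
    by rewrite -natrB; [congr (_%:R) |]; have := ltn_ord i; lia.
  rewrite -(natr1 i).
  rewrite natrD natrM; transitivity (6 * i%:R + 7 - (6 * l%:R + 1) : F); last by ring.
  by rewrite p0 subr0.
have X2 : \prod_(i < l) (6 * (l + i) + 7)%:R = 6 ^+ l * l`!%:R :> F.
  rewrite -prod_natrS -(prod_mulr_cst _ _ (fun i => i.+1%:R)).
  apply: eq_bigr => i _; rewrite natrD natrM natrD -(natr1 i).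
  transitivity (6 * l%:R + 1 + 6 * (i%:R + 1) : F); first by ring.
  by rewrite p0 add0r.
have Y : \prod_(i < 2 * l) (6 * i + 2)%:R = 36 ^+ l * (2 * l)`!%:R :> F.
  rewrite (_ : 36 ^+ l = (-6) ^+ (2 * l)); last by rewrite exprM; congr (_ ^+ _); ring.
  rewrite -prod_natrS -(prod_mulr_cst _ _ (fun i => i.+1%:R)).
  rewrite (prod_ord_rev _ (fun i => - 6 * i.+1%:R)); apply: eq_bigr => i _.
  have -> : (2 * l - i.+1).+1%:R = 2 * l%:R - i%:R :> F.
    by rewrite -natrM -natrB; [congr (_%:R) | ]; have := ltn_ord i; lia.
  rewrite natrD natrM; transitivity (6 * i%:R + 2 - 2 * (6 * l%:R + 1) : F); last by ring.
  by rewrite p0 mulr0 subr0.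
(* The odd factors of (2l)! are 2i + 1 = 2(3l + i + 1) in [F], hence up to powers of 2 the quotient
   (4l)!/(3l)!. *)
have half : (2 * l)`!%:R * (3 * l)`!%:R = 4 ^+ l * l`!%:R * (4 * l)`!%:R :> F.
  have -> : (4 * l)`!%:R = (3 * l)`!%:R * \prod_(i < l) (3 * l + i).+1%:R :> F.
    by rewrite -fact_cat; congr (_`!%:R); lia.
  rewrite fact_double (_ : 4 = 2 * 2) ?exprMn; last by ring.
  rewrite (_ : \prod_(i < l) (2 * i + 1)%:R = 2 ^+ l * \prod_(i < l) (3 * l + i).+1%:R).
    by ring.
  rewrite -(prod_mulr_cst _ _ (fun i => (3 * l + i).+1%:R)); apply: eq_bigr => i _.
  rewrite -(natr1 (3 * l + i)) (natrD _ (2 * i)) (natrD _ (3 * l)) !natrM.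
  transitivity (2 * i%:R + 1 + (6 * l%:R + 1) : F); last by ring.
  by rewrite p0 addr0.
have W2 : (4 * l)`!%:R * (2 * l)`!%:R = -1 :> F.
  have l4 : (4 * l < p)%N by rewrite /p; lia.
  have := Wilson_fact p_pr pF l4.
  rewrite (_ : p.-1 - 4 * l = 2 * l)%N; last by rewrite /p; lia.
  by rewrite exprM (_ : (-1) ^+ 4 = 1) ?expr1n //; ring.
have W3 : (3 * l)`!%:R ^+ 2 = - (-1) ^+ l :> F.
  have l3 : (3 * l < p)%N by rewrite /p; lia.
  have := Wilson_fact p_pr pF l3.
  rewrite (_ : p.-1 - 3 * l = 3 * l)%N; last by rewrite /p; lia.
  by rewrite exprM (_ : (-1) ^+ 3 = -1) ?expr2 //; ring.
have fermat2 : (2 ^+ l) ^+ 12 = 1 :> F.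
  have p2 : ~~ (p %| 2)%N by rewrite gtnNdvd // /p; lia.
  have := Fermat_natr p_pr pF p2.
  by rewrite /p addn1 /= mulnC exprM (exprM _ 6 2) => ->; rewrite expr1n.
have eC : 'C(4 * l, 2 * l)%:R * (2 * l)`!%:R ^+ 2 = (4 * l)`!%:R :> F.
  rewrite -(@bin_fact (4 * l) (2 * l)); last by lia.
  by rewrite (_ : 4 * l - 2 * l = 2 * l)%N ?natrM ?expr2 //; lia.
(* The missing factor -6l equals 1 in [F]. *)
have eL : (-6) ^+ l.-1 * l.-1`!%:R = (-1) ^+ l * 6 ^+ l * l`!%:R :> F.
  rewrite -exprMn mulN1r (_ : l`! = l * l.-1`!)%N; last by case: (l) l0.
  rewrite (_ : (-6) ^+ l = -6 * (-6) ^+ l.-1) ?natrM; last by rewrite -exprS prednK.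
  transitivity ((-6) ^+ l.-1 * l.-1`!%:R * (1 - (6 * l%:R + 1)) : F); last by ring.
  by rewrite p0 subr0 mulr1.
rewrite X1 X2 Y eL.
rewrite (_ : 16 ^+ (2 * l) = (2 ^+ l) ^+ 8); last first.
  by rewrite exprM [RHS]exprAC; congr (_ ^+ _); ring.
rewrite (_ : 36 = 6 * 6) ?exprMn; last by ring.
have e4 : 4 ^+ l = (2 ^+ l) ^+ 2 :> F.
  by rewrite [RHS]exprAC; congr (_ ^+ _); ring.
have ss : (-1) ^+ l * (-1) ^+ l = 1 :> F by rewrite -expr2 sqrr_sign.
rewrite e4 in half; move: half W2 W3 fermat2 eC ss.
move: (2 ^+ l) (6 ^+ l) ((-1) ^+ l) (l`!%:R) ((2 * l)`!%:R) ((3 * l)`!%:R)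
  ((4 * l)`!%:R) ('C(_, _)%:R) => t x s a b c d C half db cc t12 eC ss.
(* What remains is elimination: [d * b = -1] gives [C], and squaring [half] brings in the known
   [c ^+ 2] and gives [a ^+ 2]. *)
have eC' : C = d ^+ 3.
  transitivity (C * (d * b) ^+ 2); first by rewrite db; ring.
  by transitivity (C * b ^+ 2 * d ^+ 2); [|rewrite eC]; ring.
have ea : a ^+ 2 = - s * t ^+ 8 * b ^+ 4.
  transitivity (t ^+ 12 * a ^+ 2 * (d * b) ^+ 2); first by rewrite t12 db; ring.
  transitivity (t ^+ 8 * (t ^+ 2 * a * d) ^+ 2 * b ^+ 2); first by ring.
  by rewrite -half exprMn cc; ring.
transitivity (s * x ^+ 2 * a ^+ 2 * C); first by ring.
rewrite ea eC'; transitivity (- (s * s) * x ^+ 2 * t ^+ 8 * b * (d * b) ^+ 3); first by ring.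
by rewrite ss db; ring.
Qed.

(** Transfers identities between naturals from the prime field to Z_(p). *)
Lemma Zloc_congr_nat (p m n : nat) : prime p -> m%:R = n%:R :> 'F_p ->
  exists2 z, z \in Zloc p & m%:R - n%:R = p%:R * z :> rat.
Proof.
move=> p_pr; wlog le_nm : m n / (n <= m)%N => [IH e | e].
  have [/IH|/ltnW/IH] := leqP n m; first exact.
  by case=> // z Zz ez; exists (- z); rewrite ?ZlocN // mulrN -ez opprB.
have /dvdnP[q eq] : (p %| m - n)%N.
  by rewrite (dvdn_pcharf (pchar_Fp p_pr)) natrB // e subrr.
exists q%:R; first exact: Zloc_nat.
by rewrite -natrB // eq natrM mulrC.
Qed.

Section Prime.
Variable p : nat.
Hypothesis p_pr : prime p.
Hypothesis p_gt3 : (3 < p)%N.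

Lemma Zunit_bin n k : (n < p)%N -> (k <= n)%N -> 'C(n, k)%:R \in Zunit p.
Proof.
move=> np kn; apply: Zunit_nat => //.
have : ~~ (p %| n`!)%N by rewrite (dvdn_pcharf (pchar_Fp p_pr)) (fact_neq0 p_pr (pchar_Fp p_pr)).
by apply: contra => pC; rewrite -(bin_fact kn) dvdn_mulr.
Qed.

End Prime.

(** The closed form at 2p = 6(2l) + 2 contains an explicit factor p, so a congruence modulo p for
    the cofactor suffices. *)
Lemma hsum_2p_1mod3 l : (0 < l)%N -> prime (6 * l + 1) ->
  exists2 z, z \in Zloc (6 * l + 1) &
    - hsum rat (2 * (6 * l + 1)) - (6 * l + 1)%:R / 'C(4 * l, 2 * l)%:R
    = (6 * l + 1)%:R ^+ 2 * z.
Proof.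
move=> l0 p_pr; set p := (6 * l + 1)%N in p_pr *.
have := binomial_mod_p l0 p_pr (pchar_Fp p_pr).
pose X1 := (\prod_(i < l.-1) (6 * i + 7))%N.
pose X2 := (\prod_(i < l) (6 * (l + i) + 7))%N.
pose Y := (\prod_(i < 2 * l) (6 * i + 2))%N.
rewrite -!natr_prod -/X1 -/X2 -/Y -!natrM -natrX -natrM => /(Zloc_congr_nat p_pr) [z Zz ez].
have UC : 'C(4 * l, 2 * l)%:R \in Zunit p by apply: Zunit_bin => //; rewrite /p; lia.
have U2 : 2 \in Zunit p by apply: Zunit_small => //; rewrite /p; lia.
have U16 : 16 ^+ (2 * l) \in Zunit p.
  by apply/ZunitX; rewrite (_ : 16 = 2 ^+ 4) ?ZunitX //; ring.
have UY : Y%:R \in Zunit p.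
  rewrite natr_prod; apply: Zunit_prod => i _.
  rewrite (_ : 6 * i + 2 = 2 * (3 * i + 1))%N ?natrM; last by lia.
  by apply: ZunitM => //; apply: Zunit_small => //; have := ltn_ord i; rewrite /p; lia.
(* The factor p sits at i = l - 1. *)
have e7 : (\prod_(i < 2 * l) (6 * i + 7) = p * (X1 * X2))%N.
  rewrite (_ : 2 * l = l.-1.+1 + l)%N; last by lia.
  rewrite big_split_ord big_ord_recr /= -/X1.
  rewrite (_ : 6 * l.-1 + 7 = p)%N; last by rewrite /p; lia.
  rewrite [(X1 * p)%N]mulnC -mulnA; congr (_ * (_ * _))%N.
  by apply: eq_bigr => i _; rewrite prednK.
have hY : hsum rat (2 * p) = - (p%:R * (X1 * X2)%:R / (16 ^+ (2 * l) * Y%:R)).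
  rewrite (_ : 2 * p = 6 * (2 * l) + 2)%N; last by rewrite /p; lia.
  rewrite hsum_2mod6; last by lia.
  rewrite prodrN card_ord exprM (_ : (-1) ^+ 2 = 1) ?expr1n ?mul1r; last by ring.
  under eq_bigr do rewrite natrM.
  rewrite big_split /= prodfV; congr (- (_ / _)).
    by rewrite -natr_prod e7 natrM.
  by rewrite natr_prod -(prod_mulr_cst _ _ (fun i => (6 * i + 2)%:R)).
exists (z / (16 ^+ (2 * l) * Y%:R * 'C(4 * l, 2 * l)%:R)).
  by rewrite !invfM; Zloc_closed; apply: ZlocV.
have C0 := Zunit_neq0 UC; have Y0 := Zunit_neq0 UY; have s0 := Zunit_neq0 U16.
rewrite hY opprK.
transitivity (p%:R * ((X1 * X2 * 'C(4 * l, 2 * l))%:R - (16 ^ (2 * l) * Y)%:R)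
   / (16 ^+ (2 * l) * Y%:R * 'C(4 * l, 2 * l)%:R) : rat).
  rewrite (natrM _ (X1 * X2)) (natrM _ (16 ^ _)) natrX.
  by field; rewrite C0 Y0 s0.
by rewrite ez; field; rewrite C0 Y0 s0.
Qed.

(* With p = 3m - 1 and t = m + i the factors are 3t - p and 3t.  As t <-> p - t
   permutes the range of t and (3t-p)(3(p-t)-p) = 9t(p-t) - 2p^2, the squares
   of both products agree modulo p^2. *)
Lemma prod_third_congr m : prime (3 * m - 1) -> (1 < m)%N ->
  exists2 z, z \in Zloc (3 * m - 1) &
    \prod_(i < m) (3 * i + 1)%:R - \prod_(i < m) (3 * (m + i))%:R
    = (3 * m - 1)%:R ^+ 2 * z :> rat.
Proof.
set p := (3 * m - 1)%N => p_pr m1.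
have p_gt3 : (3 < p)%N by rewrite /p; lia.
have ep : p%:R = 3 * m%:R - 1 :> rat by rewrite /p natrB ?natrM //; lia.
set X := \prod_(i < m) (3 * i + 1)%:R; set Y := \prod_(i < m) (3 * (m + i))%:R.
have UY : Y \in Zunit p.
  apply: Zunit_prod => i _; rewrite natrM.
  by apply: ZunitM; apply: Zunit_small => //; have := ltn_ord i; rewrite /p; lia.
have [a Za eX] : exists2 a, a \in Zloc p & X = Y + p%:R * a.
  have := @affine_prod p m (fun i => (3 * (m + i))%:R) (fun i => (3 * i + 1)%:R)
    (fun i => (3 * (m + i))%:R - 2 * p%:R).
  case=> [i _|_ [a Za [eX _]]]; last by exists a.
  apply: (@affine_linear _ _ (-1)); Zloc_closed; last by ring.
  by rewrite ep natrD !natrM (natrD _ m); ring.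
(* A triple whose first two entries coincide expresses a congruence modulo p^2 with the third, and
   such triples multiply. *)
have [c Zc eXY] : exists2 c, c \in Zloc p & X ^+ 2 = Y ^+ 2 + p%:R ^+ 2 * c.
  have := @affine_prod p m (fun i => (3 * (m + i))%:R * (3 * (m + (m - i.+1)))%:R)
    (fun i => (3 * (m + i))%:R * (3 * (m + (m - i.+1)))%:R)
    (fun i => (3 * i + 1)%:R * (3 * (m - i.+1) + 1)%:R).
  case=> [i im|_ [b Zb [e [c Zc]]]].
    split; first by Zloc_closed.
    exists 0; first by Zloc_closed.
    split; first by rewrite mulr0 addr0.
    exists (- 2); first by Zloc_closed.
    rewrite ep (natrD _ (3 * i)) (natrD _ (3 * _)) !natrM !(natrD _ m) natrB //.
    by rewrite -(natr1 i); ring.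
  have b0 : p%:R * b = 0 by apply: addrI; rewrite addr0; exact/esym/e.
  rewrite -mulrA b0 mulr0 addr0 !big_split /=.
  rewrite -(prod_ord_rev _ (fun i => (3 * i + 1)%:R)).
  rewrite -(prod_ord_rev _ (fun i => (3 * (m + i))%:R)) => h.
  by exists c; rewrite // !expr2.
(* X + Y is 2Y modulo p, so it can be cancelled from X^2 - Y^2. *)
have US : X + Y \in Zunit p.
  have -> : X + Y = 2 * Y + p%:R * a by rewrite eX; ring.
  by apply: ZunitD => //; apply: ZunitM => //; apply: Zunit_small => //; lia.
exists (c / (X + Y)); first by Zloc_closed; apply: ZlocV.
apply: (mulIf (Zunit_neq0 US)); rewrite mulrA divfK ?(Zunit_neq0 US) //.
by rewrite -subr_sqr eXY; ring.
Qed.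

(** The odd factors of (2M+2)! times its even factors 2, 4, ..., 2M+2. *)
Lemma odd_prod_fact (R : comPzRingType) M :
  \prod_(i < M) (2 * i + 3)%:R * M.+1`!%:R * 2 ^+ M.+1 = (2 * M.+1)`!%:R :> R.
Proof.
elim: M => [|M IH]; first by rewrite big_ord0 !mul1r.
have -> : (2 * M.+2)`! = ((2 * M + 4) * ((2 * M + 3) * (2 * M.+1)`!))%N.
  rewrite (_ : 2 * M.+2 = (2 * M.+1).+2)%N; last by lia.
  by rewrite !factS; congr (_ * (_ * _))%N; lia.
have -> : M.+2`! = ((M + 2) * M.+1`!)%N by rewrite factS addn2.
rewrite mulnA 2!natrM -IH big_ord_recr /= exprS natrM.
rewrite (natrD _ M) (natrD _ (2 * M) 4) natrM; ring.
Qed.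

Lemma affine_pow2 p : prime p -> (2 < p)%N -> affine p 1 (2 ^+ p.-1) (4 ^+ p.-1).
Proof.
move=> p_pr p2; split; first by Zloc_closed.
have [] := @Zloc_congr_nat p (2 ^ p.-1) 1 p_pr.
  rewrite natrX (Fermat_natr p_pr (pchar_Fp p_pr)) // gtnNdvd //.
(* The slope [q] is the Fermat quotient of 2, and 4^(p-1) = (1 + p q)^2. *)
move=> q Zq; rewrite natrX => e; exists q => //.
have e2 : 2 ^+ p.-1 = 1 + p%:R * q :> rat by rewrite -e; ring.
split => //; exists (q ^+ 2); first by Zloc_closed.
by rewrite (_ : 4 = 2 ^+ 2) -?exprM ?[(2 * _)%N]mulnC ?exprM ?e2; ring.
Qed.

(** * Closed forms at p and 2p when p = 6 l + 5 *)

Section TwoModThree.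
Variables (R : realFieldType) (l : nat).
Local Notation p := (6 * l + 5)%N.
Local Notation M := (2 * l + 1)%N.
Local Notation m := (2 * l + 2)%N.

Let C : R := 'C(2 * m, m)%:R.

Lemma odd_prod_bin : \prod_(i < M) (2 * i + 3)%:R * 2 ^+ m = C * m`!%:R.
Proof.
have := odd_prod_fact R M; rewrite (_ : M.+1 = m)%N => [e|]; last by lia.
apply: (mulIf (natr_fact_neq0 R m)); rewrite mulrAC e -(@bin_fact (2 * m) m); last by lia.
by rewrite (_ : 2 * m - m = m)%N ?natrM ?mulrA //; lia.
Qed.

(** The right side is A g(2p) with A = -(p+1) [C] and g(x) = 2^(-(p-1)x/p) times the product of
    3s/(3s - x/2) over 1 <= s <= [M]; thus g(0) = 1. *)
Lemma hsum_2p_2mod3 :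
  hsum R (2 * p) = - (p + 1)%:R * C / 4 ^+ p.-1
    * (\prod_(s < M) (3 * s.+1)%:R / \prod_(s < M) ((3 * s.+1)%:R - p%:R)).
Proof.
have -> : \prod_(s < M) ((3 * s.+1)%:R - p%:R) = - \prod_(i < M) (3 * i + 2)%:R :> R.
  rewrite (prod_ord_rev _ (fun s => (3 * s.+1)%:R - p%:R)).
  rewrite -[RHS]mulN1r (_ : -1 = (-1) ^+ M); last by rewrite exprD exprM sqrrN expr1n expr1n mul1r.
  rewrite -(prod_mulr_cst _ _ (fun i => (3 * i + 2)%:R)); apply: eq_bigr => i _.
  rewrite (_ : p = 3 * (M - i.+1).+1 + (3 * i + 2))%N; last by have := ltn_ord i; lia.
  by rewrite natrD; ring.
rewrite (_ : 2 * p = 6 * M + 4)%N; last by lia.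
rewrite hsum_4mod6; last by lia.
rewrite prodrN card_ord.
under eq_bigr => i _.
  rewrite (_ : 6 * i + 9 = 3 * (2 * i + 3))%N; last by lia.
  rewrite (_ : 16 * (6 * i + 4) = 32 * (3 * i + 2))%N; last by lia.
  rewrite (natrM _ 3) (natrM _ 32).
over.
under [in RHS]eq_bigr do rewrite natrM.
rewrite big_split /= prodfV (prod_mulr_cst _ _ (fun i => (2 * i + 3)%:R)).
rewrite (prod_mulr_cst _ _ (fun i => (3 * i + 2)%:R)).
rewrite (prod_mulr_cst _ _ (fun i => i.+1%:R)) prod_natrS.
have T0 : \prod_(i < M) (3 * i + 2)%:R != 0 :> R by apply/prodf_neq0 => i _; rewrite pnatr_eq0; lia.
have := odd_prod_bin; rewrite (_ : m = M.+1) ?factS; last by lia.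
rewrite (_ : p + 1 = 3 * M.+1)%N; last by lia.
rewrite (_ : p.-1 = 3 * M + 1)%N; last by lia.
rewrite (_ : (-1) ^+ M = -1 :> R); last by rewrite exprD exprM sqrrN expr1n expr1n mul1r.
have e32 : 32 ^+ M = (2 ^+ M) ^+ 5 :> R by rewrite exprAC; congr (_ ^+ _); ring.
have e4 : 4 ^+ (3 * M + 1) = 4 * (2 ^+ M) ^+ 6 :> R.
  by rewrite addn1 exprS exprM [in RHS]exprAC; congr (_ * _ ^+ _); ring.
have t0 : 2 ^+ M != 0 :> R by rewrite expf_neq0 ?pnatr_eq0.
rewrite e32 e4 exprS !natrM.
move: C (2 ^+ M) (3 ^+ M) t0 (\prod_(i < M) (3 * i + 2)%:R) T0 => c t x t0 T T0.
move: (\prod_(i < M) _) (M.+1%:R) (M`!%:R) => O k f e.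
transitivity (3 / 2 * x * O / (t ^+ 5 * T)); first by field; rewrite t0 T0.
have -> : O = c * (k * f) / (2 * t) by rewrite -e; field.
by field; rewrite t0 T0.
Qed.


(** With the same g, the quotient of f(p) by A g(p) is the quotient of the two products compared in
    [prod_third_congr]. *)
Lemma hsum_p_2mod3 :
  - (p + 1)%:R * C / 2 ^+ p.-1
    * (\prod_(s < M) (3 * s.+1)%:R / \prod_(s < M) ((3 * s.+1)%:R - p%:R / 2))
    * \prod_(i < m) (3 * i + 1)%:R
  = hsum R p * \prod_(i < m) (3 * (m + i))%:R.
Proof.
(* Doubled, the factors are 6s - p with 1 <= s <= 2l + 1: negative up to s = l, positive
   afterwards. *)
have -> : \prod_(s < M) ((3 * s.+1)%:R - p%:R / 2) =
    (-1) ^+ l * (\prod_(i < l) (6 * i + 5)%:R * \prod_(i < l.+1) (6 * i + 1)%:R)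
      / 2 ^+ M :> R.
  apply: (canRL (mulfK _)); first by rewrite expf_neq0 ?pnatr_eq0.
  rewrite mulrC -(prod_mulr_cst _ _ (fun s => (3 * s.+1)%:R - p%:R / 2)).
  rewrite mulrA -(prod_mulr_cst _ _ (fun i => (6 * i + 5)%:R)).
  rewrite (_ : M = l + l.+1)%N; last by lia.
  rewrite (prod_ord_cat _ _ (fun s => 2 * ((3 * s.+1)%:R - p%:R / 2))).
  rewrite (prod_ord_rev _ (fun s => 2 * ((3 * s.+1)%:R - p%:R / 2))).
  congr (_ * _); apply: eq_bigr => i _.
    rewrite (_ : p = 2 * (3 * (l - i.+1).+1) + (6 * i + 5))%N; last by have := ltn_ord i; lia.
    by rewrite natrD natrM; field.
  have -> : (3 * (l + i).+1)%:R = ((6 * i + 1)%:R + p%:R) / 2 :> R.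
    rewrite -natrD (_ : 6 * i + 1 + p = 3 * (l + i).+1 * 2)%N; last by lia.
    by rewrite (natrM _ _ 2) mulfK ?pnatr_eq0.
  by field.
(* Even and odd indices are separated; the first odd one contributes the 4. *)
have -> : \prod_(i < m) (3 * i + 1)%:R =
    \prod_(i < l.+1) (6 * i + 1)%:R * (4 * \prod_(i < l) (6 * i + 10)%:R) :> R.
  have -> : 4 * \prod_(i < l) (6 * i + 10)%:R = \prod_(i < l.+1) (6 * i + 4)%:R :> R.
    rewrite big_ord_recl; congr (_ * _); apply: eq_bigr => i _.
    by congr (_%:R); rewrite /= /bump; lia.
  rewrite -big_split /= (_ : m = 2 * l.+1)%N; last by lia.
  elim: (l.+1) => [|k IH]; first by rewrite !big_ord0.
  rewrite (_ : 2 * k.+1 = (2 * k).+2)%N; last by lia.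
  rewrite !big_ord_recr /= IH -mulrA; congr (_ * (_ * _)); congr (_%:R); lia.
have eY : 2 * \prod_(i < m) (3 * (m + i))%:R = 3 ^+ m * C * m`!%:R :> R.
  under eq_bigr do rewrite natrM.
  rewrite (prod_mulr_cst _ _ (fun i => (m + i)%:R)).
  have e1 : (2 * m)`!%:R = C * m`!%:R ^+ 2.
    rewrite -(@bin_fact (2 * m) m); last by lia.
    by rewrite (_ : 2 * m - m = m)%N ?natrM ?expr2 //; lia.
  have e2 : (2 * m)`!%:R = 2 * m`!%:R * \prod_(i < m) (m + i)%:R :> R.
    have -> : \prod_(i < m) (m + i)%:R = \prod_(i < m) (M + i).+1%:R :> R.
      by apply: eq_bigr => i _; congr (_%:R); lia.
    have -> : m`! = (m * M`!)%N by rewrite addn1 addn2 factS.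
    have -> : (2 * m)`! = (2 * m * (M + m)`!)%N.
      by rewrite (_ : 2 * m = (M + m).+1)%N ?factS //; lia.
    rewrite natrM fact_cat !natrM; ring.
  apply: (mulIf (natr_fact_neq0 R m)).
  transitivity (3 ^+ m * (2 * m)`!%:R : R); first by rewrite e2; ring.
  by rewrite e1; ring.
rewrite hsum_5mod6 prodrN card_ord.
under [in RHS]eq_bigr do rewrite natrM.
rewrite big_split /= prodfV (prod_mulr_cst _ _ (fun i => (6 * i + 5)%:R)).
have -> : \prod_(s < M) (3 * s.+1)%:R = 3 ^+ M * M`!%:R :> R.
  rewrite -prod_natrS -(prod_mulr_cst _ _ (fun i => i.+1%:R)).
  by apply: eq_bigr => i _; rewrite natrM.
apply: (mulfI (x := 2)); first by rewrite pnatr_eq0.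
rewrite [RHS]mulrCA eY.
have Q0 : \prod_(i < l) (6 * i + 5)%:R != 0 :> R.
  by apply/prodf_neq0 => i _; rewrite pnatr_eq0; lia.
have V0 : \prod_(i < l.+1) (6 * i + 1)%:R != 0 :> R.
  by apply/prodf_neq0 => i _; rewrite pnatr_eq0; lia.
have -> : m`!%:R = m%:R * M`!%:R :> R by rewrite -natrM addn1 addn2 factS.
rewrite (_ : 3 ^+ m = 3 * 3 ^+ M :> R); last by rewrite -exprS; congr (_ ^+ _); lia.
rewrite (_ : p + 1 = 3 * m)%N ?natrM; last by lia.
rewrite (_ : 2 ^+ M = 2 * (2 ^+ l) ^+ 2 :> R); last first.
  by rewrite addn1 exprS mulnC exprM.
rewrite (_ : 2 ^+ p.-1 = 16 * (2 ^+ l) ^+ 6 :> R); last first.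
  rewrite (_ : p.-1 = 4 + l * 6)%N; last by lia.
  by rewrite exprD exprM; congr (_ * _); ring.
rewrite (_ : 16 ^+ l = (2 ^+ l) ^+ 4 :> R); last first.
  by rewrite [RHS]exprAC; congr (_ ^+ _); ring.
have t0 : 2 ^+ l != 0 :> R by rewrite expf_neq0 ?pnatr_eq0.
have ss : (-1) ^+ l * (-1) ^+ l = 1 :> R by rewrite -expr2 sqrr_sign.
have s0 : (-1) ^+ l != 0 :> R by rewrite signr_eq0.
move: (\prod_(i < l) _) Q0 (\prod_(i < l.+1) _) V0 => Q Q0 V V0.
move: (\prod_(i < l) _) (3 ^+ M) (M`!%:R) (m%:R) => W x f k.
move: (2 ^+ l) t0 ((-1) ^+ l) s0 ss => t t0 s s0 ss.
have si : s^-1 = s by rewrite -[RHS]mulr1 -(mulfV s0) mulrA ss mul1r.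
by rewrite !invfM si; field; rewrite t0 Q0 V0.
Qed.

End TwoModThree.

(* [A], [B], [hsum (2 p)] is an affine triple, and [hsum p * Y = B * X] where
   [X] and [Y], the products of [prod_third_congr], agree modulo p^2. *)
Lemma hsum_2mod3 l : prime (6 * l + 5) ->
  exists2 z, z \in Zloc (6 * l + 5) &
    2 * hsum rat (6 * l + 5) - hsum rat (2 * (6 * l + 5))
    + (6 * l + 5 + 1)%:R * 'C(2 * (2 * l + 2), 2 * l + 2)%:R
    = (6 * l + 5)%:R ^+ 2 * z.
Proof.
set p := (6 * l + 5)%N => p_pr; have p_gt3 : (3 < p)%N by rewrite /p; lia.
pose M := (2 * l + 1)%N; pose m := (2 * l + 2)%N.
pose A : rat := - (p + 1)%:R * 'C(2 * m, m)%:R.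
pose P0 : rat := \prod_(s < M) (3 * s.+1)%:R.
pose B := A / 2 ^+ p.-1 * (P0 / \prod_(s < M) ((3 * s.+1)%:R - p%:R / 2)).
have ZA : A \in Zloc p by rewrite /A; Zloc_closed.
have UP0 : P0 \in Zunit p.
  apply: Zunit_prod => i _; rewrite natrM.
  by apply: ZunitM; apply: Zunit_small => //; have := ltn_ord i; rewrite /M /p; lia.
have ZV := @ZlocV p.
have Z2 : 2^-1 \in Zloc p by apply/ZV/Zunit_small => //; rewrite /p; lia.
have aff : affine p A B (hsum rat (2 * p)).
  rewrite hsum_2p_2mod3 -/p -/M -/m -/A -/P0.
  (* This displays [A] as A g(0), factor by factor parallel to [B] = A g(p). *)
  have {1}-> : A = A / 1 * (P0 / P0) by rewrite divr1 divff ?mulr1 ?(Zunit_neq0 UP0).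
  apply: affineM.
    apply: affineM; first exact: affine_cst.
    apply: affineV => //; last by apply: affine_pow2 => //; lia.
    by rewrite inE invr1 rpred1 oner_neq0.
  apply: affineM; first exact/affine_cst/ZunitZ.
  apply: affineV => //.
  apply: (@affine_prod p M (fun s => (3 * s.+1)%:R)
     (fun s => (3 * s.+1)%:R - p%:R / 2) (fun s => (3 * s.+1)%:R - p%:R)) => i _.
  by apply: (@affine_linear _ _ (- 2^-1)); Zloc_closed; field.
have [ZA' [a Za [eB [c Zc e2p]]]] := aff.
have ep : (3 * m - 1 = p)%N by rewrite /m /p; lia.
have m1 : (1 < m)%N by rewrite /m /p; lia.
pose X : rat := \prod_(i < m) (3 * i + 1)%:R.
pose Y : rat := \prod_(i < m) (3 * (m + i))%:R.
have := @prod_third_congr m; rewrite ep -/X -/Y => /(_ p_pr m1) [z Zz eXY].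
have UY : Y \in Zunit p.
  apply: Zunit_prod => i _; rewrite natrM.
  by apply: ZunitM; apply: Zunit_small => //; have := ltn_ord i; rewrite /m /p; lia.
have Y0 := Zunit_neq0 UY.
have eH : B * X = hsum rat p * Y by apply: hsum_p_2mod3.
have -> : hsum rat p = B + p%:R ^+ 2 * (B * z / Y).
  apply: (mulIf Y0); rewrite -eH mulrDl mulrA divfK //.
  have -> : X = Y + p%:R ^+ 2 * z by rewrite -eXY; ring.
  by ring.
(* Since 2B - f(2p) = A - p^2 c, only the correction of f(p) relative to [B] is added. *)
exists (2 * (B * z / Y) - c).
  have ZB : B \in Zloc p by rewrite eB; Zloc_closed.
  by have ZY := ZV _ UY; Zloc_closed.
rewrite e2p eB (_ : (p + 1)%:R * _ = - A); first by ring.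
by rewrite /A mulNr opprK.
Qed.

(** * Reduction to f(p) and f(2p), and the two residue classes *)

Theorem theorem1p3 (p : nat) (p_pr : prime p) (p_gt3 : (3 < p)%N) :
  let S : rat :=
    \sum_(k < p) (k + 1)%:R * 'C(3 * k, k)%:R * 'C(2 * k, k)%:R / 24%:R ^+ k in
  ((p = 1 %[mod 3])%N ->
     Zloc_congr p (p ^ 2)
       S (p%:R / 'C((2 * p - 2) %/ 3, (p - 1) %/ 3)%:R)) /\
  ((p = 2 %[mod 3])%N ->
     Zloc_congr p (p ^ 2)
       S (- (p + 1)%:R * 'C((2 * p + 2) %/ 3, (p + 1) %/ 3)%:R)).
Proof.
move=> S.
(* Oddness turns the residue modulo 3 into one modulo 6, as the closed forms require. *)
have odd_p : odd p by case: (even_prime p_pr) => // p2; move: p_gt3; rewrite p2.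
have eS : S = \sum_(k < p) term 0 k by apply: eq_bigr => k _; rewrite term_at0.
have S_congr : (p %% 3 != 0)%N -> exists2 c, c \in Zloc p &
    S = 2 * hsum rat p - hsum rat (2 * p) + p%:R ^+ 2 * c.
  move=> p3; have := sum_term_affine p_pr p_gt3 p3; rewrite -eS.
  by case=> _ [a Za [-> [c Zc ->]]]; exists c => //; ring.
have ZS : S \in Zloc p.
  rewrite eS; apply: rpred_sum => k _.
  by have [] := term_affine p_pr p_gt3 (ltn_ord k).
split=> p3; split=> //; rewrite ?natrX.
- apply: ZlocM; first exact: Zloc_nat.
  by apply/ZlocV/Zunit_bin => //; lia.
- have [|c Zc ->] := S_congr; first by lia.
  pose l := (p %/ 6)%N; have ep : (p = 6 * l + 1)%N by rewrite /l; lia.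
  have l0 : (0 < l)%N by lia.
  have := hsum_2p_1mod3 l0; rewrite -ep => /(_ p_pr) [z Zz ez].
  exists (z + c); first exact: ZlocD.
  rewrite (_ : (2 * p - 2) %/ 3 = 4 * l)%N; last by lia.
  rewrite (_ : (p - 1) %/ 3 = 2 * l)%N; last by lia.
  rewrite {1}ep hsum_1mod6 mulr0 sub0r mulrDr -ez; ring.
- by Zloc_closed.
have [|c Zc ->] := S_congr; first by lia.
pose l := (p %/ 6)%N; have ep : (p = 6 * l + 5)%N by rewrite /l; lia.
have := @hsum_2mod3 l; rewrite -ep => /(_ p_pr) [z Zz ez].
exists (z + c); first exact: ZlocD.
rewrite (_ : (2 * p + 2) %/ 3 = 2 * (2 * l + 2))%N; last by lia.
rewrite (_ : (p + 1) %/ 3 = 2 * l + 2)%N; last by lia.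
by rewrite mulrDr -ez; ring.
Qed.
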